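(* Let $l\ge2$ be an integer, let $c>0$ and $\alpha\in(0,1)$, and let $q_n=1-\frac{c}{n^\alpha}$ (for $n$ large enough that $q_n\in(0,1)$). Then there exist constants $C_l^{(-)},C_l^{(+)}>0$ (not depending on $n$) such that, for all sufficiently large $n$, $$ C_l^{(-)} n^{1-(l-1)\alpha}\le E_n^{q_n}N^{(n)}_l\le C_l^{(+)} n^{1-(l-1)\alpha}. $$ In particular, $$ \lim_{n\to\infty}E_n^{q_n}N^{(n)}_l=\begin{cases}\infty,& \text{if } l<\frac{1+\alpha}\alpha;\\ 0,& \text{if } l>\frac{1+\alpha}\alpha.\end{cases} $$
   Context: $S_n$ is the set of permutations $\sigma=\sigma_1\sigma_2\cdots\sigma_n$ of $[n]=\{1,\dots,n\}$. For $q>0$, the Mallows distribution with parameter $q$ is the probability measure on $S_n$ given by $P_n^q(\sigma)=\frac{q^{\mathrm{inv}(\sigma)}}{Z_n(q)}$, where $\mathrm{inv}(\sigma)$ is the number of inversions of $\sigma$ and $Z_n(q)$ is the normalizing constant, $Z_n(q)=\prod_{k=1}^n\frac{1-q^k}{1-q}$ (for $q\ne1$). $E_n^q$ denotes expectation under $P_n^q$. For $l\ge2$ and $1\le k\le n-l+1$, $A^{(n)}_{l;k}\subset S_n$ is the event that the set of $l$ consecutive numbers $\{k,k+1,\dots,k+l-1\}$ appears in a set of $l$ consecutive positions, i.e. there exists $m\in\{1,\dots,n-l+1\}$ with $\{k,k+1,\dots,k+l-1\}=\{\sigma_m,\sigma_{m+1},\dots,\sigma_{m+l-1}\}$. $N^{(n)}_l=\sum_{k=1}^{n-l+1}1_{A^{(n)}_{l;k}}$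 denotes the number of sets of $l$ consecutive numbers appearing in sets of consecutive positions. *)

(* Defs.v *)
From mathcomp Require Import all_boot all_order all_algebra all_fingroup.
From mathcomp Require Import all_classical all_reals all_analysis.
Set Implicit Arguments.
Unset Strict Implicit.
Unset Printing Implicit Defensive.
Import Order.TTheory GRing.Theory Num.Theory.
Import numFieldNormedType.Exports.
Local Open Scope ring_scope.

(* Positions and values of a permutation both range over 'I_n = {0, ..., n-1}:
   s i is the (0-based) value in the (0-based) position i. *)

Definition inv (n : nat) (s : 'S_n) : nat :=
  #|[set p : 'I_n * 'I_n | (p.1 < p.2)%N && (s p.2 < s p.1)%N]|.

(* Z is defined as the normalizing constant, for every q; for q != 1 it has the
   closed form \prod_(1 <= k < n.+1) ((1 - q ^+ k) / (1 - q)). *)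
Definition mallowsZ (R : realType) (n : nat) (q : R) : R :=
  \sum_(s : 'S_n) q ^+ inv s.

Definition mallows (R : realType) (n : nat) (q : R) (s : 'S_n) : R :=
  q ^+ inv s / mallowsZ n q.

Definition mallows_expectation (R : realType) (n : nat) (q : R)
    (X : 'S_n -> R) : R :=
  \sum_(s : 'S_n) mallows q s * X s.

Definition block (n l k : nat) : {set 'I_n} :=
  [set i : 'I_n | (k <= i < k + l)%N].

(* The range of m is 'I_(n.+1 - l), i.e. m + l <= n; it is empty when n < l. *)
Definition clustered (n l k : nat) : {set 'S_n} :=
  [set s : 'S_n | [exists m : 'I_(n.+1 - l), block n l k == s @: block n l m]].

Definition num_clusters (n l : nat) (s : 'S_n) : nat :=
  (\sum_(k < n.+1 - l) (s \in clustered n l k))%N.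

Lemma mallowsZ_gt0 (R : realType) (n : nat) (q : R) : 0 < q -> 0 < mallowsZ n q.
Proof.
move=> q0; rewrite /mallowsZ (bigD1 (1%g : 'S_n)) //=.
by rewrite ltr_pwDl ?exprn_gt0// sumr_ge0// => s _; rewrite exprn_ge0// ltW.
Qed.

Lemma mallows_ge0 (R : realType) (n : nat) (q : R) (s : 'S_n) :
  0 < q -> 0 <= mallows q s.
Proof. by move=> q0; rewrite divr_ge0 ?exprn_ge0 ?ltW ?mallowsZ_gt0. Qed.

Lemma mallows_sum1 (R : realType) (n : nat) (q : R) :
  0 < q -> \sum_(s : 'S_n) mallows q s = 1.
Proof.
by move=> q0; rewrite -mulr_suml divff// gt_eqF// mallowsZ_gt0.
Qed.

(* Main.v *)
(* If s in S_(N+l) maps the block of positions {m,...,m+l-1} onto the block of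
   values {k,...,k+l-1}, then s is made of a permutation t of the block, a
   permutation r of the N remaining points, and m; and
   inv s = inv t + inv r + l * X, where X = cross r m k counts the inversions
   created by inserting a single point of value k at position m into r.  So the
   weight of the event A_(l;k) is Z_l times the sum over m and r of
   q^(inv r) y^l with y = q^X.
   For l = 1 the event is certain, which gives the first moment: the sum of
   q^(inv r) y is Z_(N+1) = Z_N (1 - q^(N+1)) / (1 - q).  As y^l <= y this is
   already the upper bound.  For the lower bound, X >= |m - k| makes the part of
   the first moment where y is small negligible compared with Z_N / (1 - q), and
   y^l is at least a constant times y on the rest.
   Since Z_N / Z_(N+l) is (1 - q)^l up to constants, each A_(l;k) has probability
   of order (1 - q)^(l-1) as soon as q^(N+1) <= 1/2, and there are N + 1 values
   of k. *)
Require Import Defs.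
From mathcomp Require Import all_boot all_order all_algebra all_fingroup.
From mathcomp Require Import all_classical all_reals all_analysis.
From mathcomp Require Import zify ring lra.
Import Order.TTheory GRing.Theory Num.Theory.
Import numFieldNormedType.Exports.
Local Open Scope classical_set_scope.
Local Open Scope ring_scope.

(** * Permutations mapping a block of positions onto a block of values *)

Lemma inv_sum n (s : 'S_n) :
  Defs.inv s = (\sum_(x < n) \sum_(y < n) ((x < y) && (s y < s x))%N)%N.
Proof.
rewrite /Defs.inv -sum1_card big_mkcond pair_big /=; apply: eq_bigr => -[x y] _.
by rewrite inE /=; case: (_ && _).
Qed.

Lemma emb_subproof {l N} (k : 'I_N.+1) (x : 'I_l + 'I_N) :
  ((match x with
    | inl i => k + i | inr j => if j < k then j : nat else j + l end) < N + l)%N.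
Proof.
have := ltn_ord k; case: x => [i|j]; first by have := ltn_ord i; lia.
by have := ltn_ord j; case: ifP; lia.
Qed.

(* [inl] enumerates the block starting at k, [inr] its complement, in order. *)
Definition emb {l N} (k : 'I_N.+1) (x : 'I_l + 'I_N) : 'I_(N + l) :=
  Ordinal (emb_subproof k x).

Lemma emb_inj {l N} (k : 'I_N.+1) : injective (@emb l N k).
Proof.
move=> [i|j] [i'|j'] /(congr1 val)/=.
- by move=> ?; congr inl; apply: ord_inj; lia.
- by have := ltn_ord i; case: ifP; lia.
- by have := ltn_ord i'; case: ifP; lia.
- by do 2?[case: ifP] => ? ? ?; congr inr; apply: ord_inj; lia.
Qed.

Lemma emb_surj {l N} (k : 'I_N.+1) (x : 'I_(N + l)) : exists y, emb k y == x.
Proof.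
have [g _ gK] : bijective (@emb l N k).
  by apply: inj_card_bij; [exact: emb_inj | rewrite card_sum !card_ord addnC].
by exists (g x); rewrite gK.
Qed.

Definition unemb {l N} (k : 'I_N.+1) (x : 'I_(N + l)) : 'I_l + 'I_N :=
  xchoose (emb_surj k x).

Lemma unembK {l N} (k : 'I_N.+1) : cancel (@unemb l N k) (emb k).
Proof. by move=> x; apply/eqP; exact: (xchooseP (emb_surj k x)). Qed.

Lemma embK {l N} (k : 'I_N.+1) : cancel (@emb l N k) (unemb k).
Proof. by move=> x; apply: (emb_inj k); rewrite unembK. Qed.

Lemma emb_block {l N} (k : 'I_N.+1) (x : 'I_l + 'I_N) :
  (emb k x \in block (N + l) l k) = (if x is inl _ then true else false).
Proof.
rewrite inE; case: x => [i|j] /=; first by have := ltn_ord i; lia.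
by case: ifP; lia.
Qed.

Definition inflate_fun {l N} (m k : 'I_N.+1) (t : 'S_l) (r : 'S_N) x :=
  emb k (match unemb m x with inl i => inl (t i) | inr j => inr (r j) end).

Lemma inflate_fun_inj {l N} (m k : 'I_N.+1) (t : 'S_l) (r : 'S_N) :
  injective (inflate_fun m k t r).
Proof.
move=> x y /emb_inj; rewrite -{2}[x](unembK m) -{2}[y](unembK m).
case: (unemb m x) (unemb m y) => [i|j] [i'|j'] //.
- by move=> [] /perm_inj ->.
- by move=> [] /perm_inj ->.
Qed.

Definition inflate {l N} (m k : 'I_N.+1) (t : 'S_l) (r : 'S_N) : 'S_(N + l) :=
  perm (@inflate_fun_inj l N m k t r).

Lemma inflate_emb {l N} (m k : 'I_N.+1) (t : 'S_l) (r : 'S_N) x :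
  inflate m k t r (emb m x) =
  emb k (match x with inl i => inl (t i) | inr j => inr (r j) end).
Proof. by rewrite permE /inflate_fun embK. Qed.

Lemma inflate_block {l N} (m k : 'I_N.+1) (t : 'S_l) (r : 'S_N) :
  inflate m k t r @: block (N + l) l m = block (N + l) l k.
Proof.
apply/setP => y; apply/imsetP/idP => [[x + ->]|].
  by rewrite -[x](unembK m) inflate_emb !emb_block; case: (unemb m x).
rewrite -[y](unembK k) emb_block; case: (unemb k y) => // i _.
exists (emb m (inl (t^-1%g i))); first by rewrite emb_block.
by rewrite inflate_emb permKV.
Qed.

Lemma block_inj {l N} (m m' : 'I_N.+1) :
  (0 < l)%N -> block (N + l) l m = block (N + l) l m' -> m = m'.
Proof.
case: l => // l _ /setP E; apply: ord_inj.
have := E (emb m (inl ord0)); have := E (emb m' (inl ord0)).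
rewrite !emb_block !inE /=; lia.
Qed.

(** The preimage of the value block is the position block, which determines [m] because it is
    nonempty; [t] and [r] are then read off on the two pieces. *)
Lemma inflate_inj {l N} (k : 'I_N.+1) : (0 < l)%N ->
  injective (fun p : 'I_N.+1 * 'S_l * 'S_N => inflate p.1.1 k p.1.2 p.2).
Proof.
move=> l0 [[m t] r] [[m' t'] r'] /= E.
have Em : m = m'.
  apply: (@block_inj l) => //.
  apply: (imset_inj (@perm_inj _ (inflate m k t r))).
  by rewrite {2}E !inflate_block.
subst m'; congr (_, _, _).
  apply/permP => i; have := congr1 (fun s : {perm _} => s (emb m (inl i))) E.
  by rewrite !inflate_emb => /emb_inj[].
apply/permP => i; have := congr1 (fun s : {perm _} => s (emb m (inr i))) E.
by rewrite !inflate_emb => /emb_inj[].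
Qed.

(** In the coordinates [emb m] on positions and [emb k] on values, [s] preserves the two summands,
    hence restricts to an injection on each. *)
Lemma inflate_surj {l N} (m k : 'I_N.+1) (s : 'S_(N + l)) :
  s @: block (N + l) l m = block (N + l) l k ->
  exists t r, s = inflate m k t r.
Proof.
move=> /setP E.
have Es x : (s (emb m x) \in block (N + l) l k) = (if x is inl _ then true else false).
  rewrite -E -(emb_block m); apply/imsetP/idP => [[y yb /perm_inj -> //]|xb].
  by exists (emb m x).
pose h x := unemb k (s (emb m x)).
have h_inj : injective h.
  by move=> x y /(can_inj (unembK k))/perm_inj/emb_inj.
have hl i : exists i', h (inl i) == inl i'.
  have := Es (inl i); rewrite -[s _](unembK k) emb_block /h.
  by case: (unemb k _) => // i' _; exists i'.
have hr i : exists i', h (inr i) == inr i'.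
  have := Es (inr i); rewrite -[s _](unembK k) emb_block /h.
  by case: (unemb k _) => // i' _; exists i'.
pose t i := xchoose (hl i); pose r i := xchoose (hr i).
have ht i : h (inl i) = inl (t i) by apply/eqP/(xchooseP (hl i)).
have hr' i : h (inr i) = inr (r i) by apply/eqP/(xchooseP (hr i)).
have t_inj : injective t.
  by move=> i j e; have := ht i; rewrite e -ht => /h_inj[].
have r_inj : injective r.
  by move=> i j e; have := hr' i; rewrite e -hr' => /h_inj[].
exists (perm t_inj), (perm r_inj); apply/permP => x.
rewrite -[x](unembK m) inflate_emb -[LHS](unembK k) -/(h _).
by case: (unemb m x) => [i|j]; rewrite permE ?ht ?hr'.
Qed.

Lemma clusteredP {l N} (k : 'I_N.+1) (s : 'S_(N + l)) :
  reflect (exists m : 'I_N.+1, s @: block (N + l) l m = block (N + l) l k)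
          (s \in clustered (N + l) l k).
Proof.
rewrite inE; apply: (iffP existsP) => -[m].
  have mN : (m < N.+1)%N by have := ltn_ord m; lia.
  by move=> /eqP ->; exists (Ordinal mN).
have mN : (m < (N + l).+1 - l)%N by have := ltn_ord m; lia.
by move=> <-; exists (Ordinal mN).
Qed.

Lemma clustered_inflate {l N} (k : 'I_N.+1) :
  clustered (N + l) l k =
  (fun p : 'I_N.+1 * 'S_l * 'S_N => inflate p.1.1 k p.1.2 p.2) @: finset.setT.
Proof.
apply/setP => s; apply/clusteredP/imsetP => [[m /inflate_surj[t [r ->]]]|].
  by exists (m, t, r).
by move=> [[[m t] r] _ ->]; exists m; rewrite inflate_block.
Qed.

(** * Inversions of an inflated permutation *)

(* The number of inversions created by inserting a point of value k at position m
   into r, the values >= k and the positions >= m being shifted up. *)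
Definition cross {N} (r : 'S_N) (m k : nat) : nat :=
  (\sum_(j < N) (((m <= j) && (r j < k)) + ((j < m) && (k <= r j))))%N.

(** Pairs inside the block give [inv t], pairs outside give [inv r]. An outside point compares in
    the same way with all [l] block points, so mixed pairs contribute [l] times those of a single
    inserted point. *)
Lemma inv_inflate {l N} (m k : 'I_N.+1) (t : 'S_l) (r : 'S_N) :
  Defs.inv (inflate m k t r) = (Defs.inv t + Defs.inv r + l * cross r m k)%N.
Proof.
have eb : bijective (@emb l N m) by exists (unemb m); [exact: embK|exact: unembK].
rewrite !inv_sum (reindex (emb m)) ?big_sumType /=; last exact: onW_bij.
under eq_bigr => i _.
  rewrite (reindex (emb m)) ?big_sumType /=; last exact: onW_bij.
  under eq_bigr => i' _ do rewrite !inflate_emb /= !ltn_add2l.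
  under [X in (_ + X)%N]eq_bigr => j _.
    rewrite !inflate_emb /=.
    rewrite (_ : (_ && _) = (m <= j) && (r j < k))%N; last first.
      by have := ltn_ord i; have := ltn_ord (t i); do 2?case: ifP; lia.
    over.
  over.
under [X in (_ + X)%N]eq_bigr => j _.
  rewrite (reindex (emb m)) ?big_sumType /=; last exact: onW_bij.
  under eq_bigr => i _.
    rewrite !inflate_emb /=.
    rewrite (_ : (_ && _) = (j < m) && (k <= r j))%N; last first.
      by have := ltn_ord i; have := ltn_ord (t i); do 2?case: ifP; lia.
    over.
  under [X in (_ + X)%N]eq_bigr => j' _.
    rewrite !inflate_emb /=.
    rewrite (_ : (_ && _) = (j < j') && (r j' < r j))%N; last by do 4?case: ifP; lia.
    over.
  over.
rewrite !big_split /= exchange_big /= !sum_nat_const card_ord.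
rewrite /cross big_split /= mulnDr.
under [X in (_ + (X + _))%N]eq_bigr => j _ do rewrite sum_nat_const card_ord.
rewrite -big_distrr /=; lia.
Qed.

Lemma sum_ltn_ord (i N : nat) : (i <= N)%N -> (\sum_(j < N) (j < i) = i)%N.
Proof.
move=> iN; rewrite -[RHS]card_ord -sum1_card (big_ord_widen N (fun=> 1%N) iN).
by rewrite [RHS]big_mkcond; apply: eq_bigr => j _; case: (j < i)%N.
Qed.

(** With [c] the number of points before [m] and below [k], a + c = m and b + c = k, so the crossing
    count a + b is at least |a - b| = |m - k|. *)
Lemma cross_ge {N} (r : 'S_N) (m k : nat) : (m <= N)%N -> (k <= N)%N ->
  ((m - k) + (k - m) <= cross r m k)%N.
Proof.
move=> mN kN; rewrite /cross big_split /=.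
set b := (\sum_(j < N) ((m <= j) && (r j < k)))%N.
set a := (\sum_(j < N) ((j < m) && (k <= r j)))%N.
pose c := (\sum_(j < N) ((j < m) && (r j < k)))%N.
have Hm : (a + c = m)%N.
  rewrite -[RHS](@sum_ltn_ord m N mN) -big_split /=; apply: eq_bigr => j _; lia.
have Hk : (b + c = k)%N.
  rewrite -[RHS](@sum_ltn_ord k N kN) [RHS](reindex_inj (@perm_inj _ r)) -big_split /=.
  apply: eq_bigr => j _; lia.
move: Hm Hk; clearbody a b c; lia.
Qed.

(** * Weights of the events and the normalizing constant *)

Lemma sum_clustered {R : realType} (q : R) {l N} (k : 'I_N.+1) : (0 < l)%N ->
  \sum_(s in clustered (N + l) l k) q ^+ Defs.inv s =
  mallowsZ l q *
  \sum_(m < N.+1) \sum_(r : 'S_N) q ^+ (Defs.inv r + l * cross r m k).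
Proof.
move=> l0; rewrite clustered_inflate big_imset /=; last by move=> ? ? _ _ /inflate_inj; apply.
rewrite (eq_bigl xpredT) => [|p]; last by rewrite inE.
rewrite -(pair_bigA _ (fun (a : 'I_N.+1 * 'S_l) (r : 'S_N) =>
  q ^+ Defs.inv (inflate a.1 k a.2 r))) /=.
rewrite -(pair_bigA _ (fun (m : 'I_N.+1) (t : 'S_l) =>
  \sum_(r : 'S_N) q ^+ Defs.inv (inflate m k t r))) /=.
rewrite mulr_sumr; apply: eq_bigr => m _.
rewrite mulr_suml; apply: eq_bigr => t _.
rewrite mulr_sumr; apply: eq_bigr => r _.
by rewrite inv_inflate -exprD addnA.
Qed.

Lemma mallowsZ1 {R : realType} (q : R) : mallowsZ 1 q = 1.
Proof.
rewrite /mallowsZ; under eq_bigr => s _ do rewrite inv_sum !big_ord1 ltnn expr0.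
by rewrite sumr_const card_Sn.
Qed.

Lemma mallowsZ_cross {R : realType} (q : R) {N} (k : 'I_N.+1) :
  mallowsZ N.+1 q =
  \sum_(m < N.+1) \sum_(r : 'S_N) q ^+ (Defs.inv r + cross r m k).
Proof.
have := @sum_clustered R q 1 N k isT; rewrite mallowsZ1 mul1r => E.
under eq_bigr => m _ do under eq_bigr => r _ do rewrite -[cross _ _ _]mul1n.
rewrite -E (_ : mallowsZ N.+1 q = mallowsZ (N + 1) q); last by rewrite addn1.
rewrite /mallowsZ; apply: eq_bigl => s; apply/esym/clusteredP.
have iE (i : 'I_N.+1) : block (N + 1) 1 i = [set emb i (inl (ord0 : 'I_1))]%SET.
  by apply/setP => j; rewrite !inE -val_eqE /=; lia.
have e : N.+1 = (N + 1)%N by rewrite addn1.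
(* For a block of size one, the position is that of the value [k]. *)
exists (cast_ord (esym e) (s^-1%g (emb k (inl (ord0 : 'I_1))))).
rewrite !iE imset_set1; congr finset.set1.
by rewrite -[RHS](permKV s); congr (s _); apply: ord_inj; rewrite /= addn0.
Qed.

(** Inserting the smallest value at position [m] creates exactly [m] inversions, so the case k = 0
    of [mallowsZ_cross] is a geometric sum. *)
Lemma mallowsZS {R : realType} (q : R) N :
  mallowsZ N.+1 q * (1 - q) = mallowsZ N q * (1 - q ^+ N.+1).
Proof.
rewrite (mallowsZ_cross q ord0).
have -> : 1 - q ^+ N.+1 = (\sum_(m < N.+1) q ^+ m) * (1 - q).
  by rewrite -opprB subrX1 mulrC -mulrN opprB.
rewrite mulrA mulr_sumr; congr (_ * _); apply: eq_bigr => m _.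
rewrite mulr_suml; apply: eq_bigr => r _; rewrite exprD; congr (_ * q ^+ _).
rewrite -[RHS](@sum_ltn_ord m N); last by have := ltn_ord m; lia.
by apply: eq_bigr => j _; rewrite ltn0 leq0n andbF andbT.
Qed.

Lemma mallowsZ_ge1 {R : realType} (q : R) n : 0 <= q -> 1 <= mallowsZ n q.
Proof.
move=> q0; rewrite /mallowsZ (bigD1 (1%g : 'S_n)) //=.
have -> : Defs.inv (1%g : 'S_n) = 0%N.
  by rewrite inv_sum big1 // => x _; rewrite big1 // => y _; rewrite !perm1; lia.
by rewrite expr0 lerDl sumr_ge0 // => s _; rewrite exprn_ge0.
Qed.

Lemma mallowsZ_le {R : realType} (q : R) n : 0 <= q <= 1 -> mallowsZ n q <= n`!%:R.
Proof.
move=> /andP[q0 q1]; rewrite -card_Sn -sumr_const /mallowsZ.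
rewrite [leRHS](eq_bigl xpredT) => [|s]; last by rewrite inE.
by apply: ler_sum => s _; rewrite exprn_ile1.
Qed.

(** By [mallowsZS], each unit increase of [l] multiplies the product by 1 - q^(N+l+1), a factor
    between 1/2 and 1. *)
Lemma mallowsZ_ratio {R : realType} (q : R) l N : 0 < q < 1 -> q ^+ N.+1 <= 2^-1 ->
  mallowsZ N q <= 2 ^+ l * ((1 - q) ^+ l * mallowsZ (N + l) q) /\
  (1 - q) ^+ l * mallowsZ (N + l) q <= mallowsZ N q.
Proof.
move=> /andP[q0 q1] qN; elim: l => [|l [IH1 IH2]].
  by rewrite addn0 !expr0 !mul1r.
have E : (1 - q) ^+ l.+1 * mallowsZ (N + l.+1) q =
         (1 - q) ^+ l * mallowsZ (N + l) q * (1 - q ^+ (N + l).+1).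
  by rewrite addnS exprSr -mulrA [_ * mallowsZ _ _]mulrC mallowsZS mulrA.
have qNl : q ^+ (N + l).+1 <= 2^-1.
  apply: le_trans qN; apply: ler_wiXn2l; [exact: ltW|exact: ltW|lia].
have qNl0 : 0 <= q ^+ (N + l).+1 by rewrite exprn_ge0 // ltW.
have A0 : 0 <= (1 - q) ^+ l * mallowsZ (N + l) q.
  by rewrite mulr_ge0 ?exprn_ge0 ?subr_ge0 ?ltW ?mallowsZ_gt0.
rewrite E; set A := _ * mallowsZ (N + l) q in IH1 IH2 A0 *.
set z := q ^+ _ in qNl qNl0 *; clearbody A z.
split; last by apply: le_trans IH2; rewrite ler_piMr //; lra.
apply: (le_trans IH1); rewrite exprS -mulrA mulrCA ler_wpM2l ?exprn_ge0 //.
have : 0 <= A * (2^-1 - z) by rewrite mulr_ge0 // subr_ge0.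
by lra.
Qed.

(** * Two elementary inequalities on powers *)

Lemma geometric_two_sided {R : realType} (p : R) (k M : nat) : 0 <= p <= 1 ->
  (\sum_(m < M) p ^+ ((m - k) + (k - m))) * (1 - p) <= 2.
Proof.
move=> /andP[p0 p1].
(* A sharper bound that is stable under induction on [M]; subtraction being truncated, one of its
   two powers is always 1. *)
suff : (\sum_(m < M) p ^+ ((m - k) + (k - m))) * (1 - p) <=
       1 - p ^+ (M - k) + p ^+ (k - M).
  move=> /le_trans; apply.
  have := exprn_ile1 (k - M) p0 p1; have := exprn_ge0 (M - k) p0; lra.
elim: M => [|M IH].
  by rewrite big_ord0 mul0r sub0n expr0 subrr add0r exprn_ge0.
rewrite big_ord_recr /= mulrDl; apply: (le_trans (lerD IH (lexx _))).
have [Mk|kM] := ltnP M k.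
  rewrite (_ : (M - k = 0)%N); last by lia.
  rewrite (_ : (M.+1 - k = 0)%N); last by lia.
  rewrite (_ : (k - M = (k - M.+1).+1)%N); last by lia.
  rewrite add0n !expr0 exprS; have := exprn_ge0 (k - M.+1) p0.
  set z := p ^+ _ => z0; have : 0 <= z * (1 - p) ^+ 2 by rewrite mulr_ge0 ?sqr_ge0.
  lra.
rewrite (_ : (k - M = 0)%N); last by lia.
rewrite (_ : (k - M.+1 = 0)%N); last by lia.
by rewrite addn0 !expr0 subSn // exprS; lra.
Qed.

(* If [y < e ^+ 2] then [y <= e * p ^+ d], being the geometric mean of two upper
   bounds; unlike the truncation level [e ^+ 2], this error is summable in [d]. *)
Lemma exprS_ge {R : realType} (e p y : R) (l d : nat) :
  0 <= e -> 0 <= p -> 0 <= y -> y <= p ^+ 2 ^+ d ->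
  e ^+ 2 ^+ l * (y - e * p ^+ d) <= y ^+ l.+1.
Proof.
move=> e0 p0 y0 yp; have pd0 : 0 <= e * p ^+ d by rewrite mulr_ge0 ?exprn_ge0.
have [ey|/ltW ye] := leP (e ^+ 2) y.
  rewrite (exprSr y); apply: (@le_trans _ _ (e ^+ 2 ^+ l * y)).
    by apply: ler_wpM2l; [do 2!apply: exprn_ge0 | rewrite gerBl].
  by apply: ler_wpM2r => //; rewrite lerXn2r // nnegrE exprn_ge0.
apply: (@le_trans _ _ 0); last by rewrite exprn_ge0.
apply: mulr_ge0_le0; [by do 2!apply: exprn_ge0 | rewrite subr_le0].
rewrite -(@ler_pXn2r _ 2) ?nnegrE // exprMn -exprM mulnC exprM expr2.
by rewrite ler_pM.
Qed.

(** * Bounds on the expectation for fixed size and parameter *)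

Lemma mallows_expectation_num_clusters {R : realType} (q : R) l N :
  mallows_expectation q (fun s : 'S_(N + l) => (num_clusters l s)%:R) =
  (\sum_(k < N.+1) \sum_(s in clustered (N + l) l k) q ^+ Defs.inv s) /
  mallowsZ (N + l) q.
Proof.
have e : (N.+1 = (N + l).+1 - l)%N by rewrite subSn ?leq_addl // addnK.
rewrite /mallows_expectation mulr_suml.
under eq_bigr => s _.
  rewrite /num_clusters natr_sum mulr_sumr (reindex (cast_ord e)) /=; last first.
    by apply: onW_bij; exists (cast_ord (esym e)); [exact: cast_ordK|exact: cast_ordKV].
  over.
rewrite exchange_big /=; apply: eq_bigr => k _.
rewrite mulr_suml [RHS]big_mkcond; apply: eq_bigr => s _.
by rewrite /mallows; case: (s \in _); rewrite ?mulr1 ?mulr0.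
Qed.

(** The factorial bounds the weight inside the block, and the power of 2 comes from
    [mallowsZ_ratio]. *)
Lemma sum_clustered_le {R : realType} (q : R) l N (k : 'I_N.+1) :
  0 < q < 1 -> q ^+ N.+1 <= 2^-1 ->
  \sum_(s in clustered (N + l.+1) l.+1 k) q ^+ Defs.inv s <=
  (l.+1)`!%:R * 2 ^+ l.+1 * (1 - q) ^+ l * mallowsZ (N + l.+1) q.
Proof.
move=> q01 qN; have /andP[q0 q1] := q01.
have q01' : 0 <= q <= 1 by rewrite !ltW.
rewrite sum_clustered // -!mulrA.
apply: ler_pM; [exact: le_trans ler01 (mallowsZ_ge1 q l.+1 (ltW q0)) | |exact: mallowsZ_le|].
  by do 2!apply: sumr_ge0 => ? _; rewrite exprn_ge0 // ltW.
apply: (@le_trans _ _ (mallowsZ N.+1 q)).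
  rewrite (mallowsZ_cross q k); apply: ler_sum => m _; apply: ler_sum => r _.
  by apply: ler_wiXn2l; rewrite ?ltW //; lia.
rewrite -(@ler_pM2r _ (1 - q)) ?subr_gt0 // mallowsZS.
have [+ _] := mallowsZ_ratio q l.+1 N q01 qN; rewrite (exprSr (1 - q)).
have : 0 <= mallowsZ N q * q ^+ N.+1.
  by rewrite mulr_ge0 ?exprn_ge0 ?ltW ?mallowsZ_gt0.
lra.
Qed.

Lemma sum_clustered_ge {R : realType} (q : R) l N (k : 'I_N.+1) :
  0 < q < 1 -> q ^+ N.+1 <= 2^-1 ->
  (16^-1 ^+ 2) ^+ l / 4 * (1 - q) ^+ l * mallowsZ (N + l.+1) q <=
  \sum_(s in clustered (N + l.+1) l.+1 k) q ^+ Defs.inv s.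
Proof.
move=> q01 qN; have /andP[q0 q1] := q01.
rewrite sum_clustered //.
set S := (X in _ <= _ * X).
have S0 : 0 <= S by do 2!apply: sumr_ge0 => ? _; rewrite exprn_ge0 // ltW.
apply: (@le_trans _ _ S); last by rewrite ler_peMl // mallowsZ_ge1 // ltW.
(* The square root gives q^|m-k| the form required by [exprS_ge]. The error sum times 1 - q is at
   most 4, so e = 1/16 costs 1/4 of the at least 1/2 provided by 1 - q^(N+1), and 1/4 remains. *)
pose p := Num.sqrt q; pose e : R := 16^-1.
have p0 : 0 <= p by exact: sqrtr_ge0.
have pq : p ^+ 2 = q by rewrite sqr_sqrtr // ltW.
have p1 : p <= 1 by rewrite -(@ler_pXn2r _ 2) ?nnegrE // expr1n pq ltW.
pose d (m : nat) := ((m - k) + (k - m))%N.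
have e0 : 0 <= e by rewrite invr_ge0.
have SE : e ^+ 2 ^+ l * (mallowsZ N.+1 q - e * (\sum_(m < N.+1) p ^+ d m) * mallowsZ N q) <= S.
  have -> : mallowsZ N.+1 q - e * (\sum_(m < N.+1) p ^+ d m) * mallowsZ N q =
    \sum_(m < N.+1) \sum_(r : 'S_N)
      q ^+ Defs.inv r * (q ^+ cross r m k - e * p ^+ d m).
    rewrite (mallowsZ_cross q k) [e * _]mulr_sumr mulr_suml -sumrB.
    apply: eq_bigr => m _; rewrite [_ * mallowsZ _ _]mulr_sumr -sumrB.
    by apply: eq_bigr => r _; rewrite exprD; ring.
  rewrite mulr_sumr; apply: ler_sum => m _; rewrite mulr_sumr.
  apply: ler_sum => r _; rewrite mulnC exprD exprM.
  rewrite mulrCA; apply: ler_wpM2l; first by rewrite exprn_ge0 // ltW.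
  apply: exprS_ge => //; first by rewrite exprn_ge0 // ltW.
  rewrite pq; apply: ler_wiXn2l; rewrite ?ltW //.
  by apply: cross_ge; have := ltn_ord m; have := ltn_ord k; lia.
have Zn0 : 0 < mallowsZ N q by exact: mallowsZ_gt0.
have main : mallowsZ N q / 4 <= (mallowsZ N.+1 q -
    e * (\sum_(m < N.+1) p ^+ d m) * mallowsZ N q) * (1 - q).
  have G := geometric_two_sided p k N.+1 (introT andP (conj p0 p1)).
  have G4 : (\sum_(m < N.+1) p ^+ d m) * (1 - q) <= 4.
    (* The factor 1 - p is absorbed by the two-sided geometric sum, and 1 + p is at most 2. *)
    have -> : 1 - q = (1 - p) * (1 + p) by rewrite -pq; ring.
    rewrite mulrA; have -> : 4 = 2 * 2 :> R by ring.
    apply: ler_pM => //; last by lra.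
    - by rewrite mulr_ge0 ?subr_ge0 ?sumr_ge0 // => m _; rewrite exprn_ge0.
    - by rewrite addr_ge0.
  rewrite mulrBl mallowsZS.
  set g := \sum_(m < N.+1) _ in G4 *.
  have -> : e * g * mallowsZ N q * (1 - q) = mallowsZ N q * (e * (g * (1 - q))) by ring.
  rewrite -mulrBr; apply: ler_wpM2l; first exact: ltW.
  by rewrite /e; lra.
have [_ Z2] := mallowsZ_ratio q l.+1 N q01 qN.
rewrite -(@ler_pM2r _ (1 - q)) ?subr_gt0 //.
apply: (@le_trans _ _ (e ^+ 2 ^+ l * (mallowsZ N q / 4))); last first.
  apply: (@le_trans _ _ (e ^+ 2 ^+ l * ((mallowsZ N.+1 q -
    e * (\sum_(m < N.+1) p ^+ d m) * mallowsZ N q) * (1 - q)))).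
    by rewrite ler_wpM2l //; do 2!apply: exprn_ge0.
  by rewrite mulrA ler_wpM2r // subr_ge0 ltW.
rewrite -/e (_ : _ * (1 - q) = e ^+ 2 ^+ l *
  ((1 - q) ^+ l.+1 * mallowsZ (N + l.+1) q / 4)); last by rewrite (exprSr (1 - q)); ring.
by apply: ler_wpM2l; [do 2!apply: exprn_ge0 | rewrite ler_pM2r].
Qed.

Lemma mallows_expectation_bounds {R : realType} (q : R) l N :
  0 < q < 1 -> q ^+ N.+1 <= 2^-1 ->
  (16^-1 ^+ 2) ^+ l / 4 * (1 - q) ^+ l * N.+1%:R <=
    mallows_expectation q (fun s : 'S_(N + l.+1) => (num_clusters l.+1 s)%:R) <=
  (l.+1)`!%:R * 2 ^+ l.+1 * (1 - q) ^+ l * N.+1%:R.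
Proof.
move=> q01 qN; have /andP[q0 q1] := q01.
rewrite mallows_expectation_num_clusters.
have Z0 : 0 < mallowsZ (N + l.+1) q by exact: mallowsZ_gt0.
rewrite ler_pdivlMr // ler_pdivrMr // -![_ * N.+1%:R * _]mulrAC.
have sumc (x : R) : x * N.+1%:R = \sum_(k < N.+1) x.
  by rewrite sumr_const card_ord mulr_natr.
rewrite !sumc.
apply/andP; split; apply: ler_sum => k _.
- exact: sum_clustered_ge.
- exact: sum_clustered_le.
Qed.

(** * Asymptotics as the size grows *)

(** A Bernoulli-type inequality, (1 - x)^m (1 + m x) <= 1, whose second factor is at least 2 at m =
    M. *)
Lemma expr_le_half {R : realType} (x : R) (M : nat) :
  0 <= x <= 1 -> 1 <= M%:R * x -> (1 - x) ^+ M <= 2^-1.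
Proof.
move=> /andP[x0 x1] Mx.
have B m : (1 - x) ^+ m * (1 + m%:R * x) <= 1.
  elim: m => [|m IH]; first by rewrite expr0 mul0r addr0 mulr1.
  apply: le_trans IH; rewrite exprSr -mulrA ler_wpM2l ?exprn_ge0 ?subr_ge0 //.
  rewrite -natr1; have : 0 <= (m%:R + 1) * x ^+ 2.
    by rewrite mulr_ge0 ?sqr_ge0 // addr_ge0.
  lra.
have p0 : 0 <= (1 - x) ^+ M by rewrite exprn_ge0 // subr_ge0.
have := B M; have : 0 <= (1 - x) ^+ M * (M%:R * x - 1) by rewrite mulr_ge0 // subr_ge0.
lra.
Qed.

Lemma cvg_natr_powR_pinfty {R : realType} (b : R) : 0 < b ->
  n%:R `^ b @[n --> \oo] --> +oo.
Proof.
move=> b0; apply/cvgryPge => A; near=> n.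
have An : `|A| `^ b^-1 <= n%:R by near: n; exact: nbhs_infty_ger.
apply: (le_trans (ler_norm A)).
have -> : `|A| = (`|A| `^ b^-1) `^ b by rewrite -powRrM mulVf ?gt_eqF // powRr1.
by apply: ge0_ler_powR => //; rewrite ?nnegrE ?powR_ge0 // ltW.
Unshelve. all: by end_near. Qed.

Lemma cvg_natr_powR0 {R : realType} (b : R) : b < 0 ->
  n%:R `^ b @[n --> \oo] --> (0 : R).
Proof.
move=> b0; have /cvg_natr_powR_pinfty H : 0 < - b by rewrite oppr_gt0.
have /gtr0_cvgV0[_ /(_ H)] : \forall n \near \oo, 0 < (n%:R : R) `^ (- b).
  by near=> n; rewrite powR_gt0 // ltr0n; near: n; exact: nbhs_infty_gt.
rewrite (_ : unstable.inv_fun _ = fun n => n%:R `^ b) //.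
by apply/funext => n; rewrite /unstable.inv_fun /= -powRN opprK.
Unshelve. all: by end_near. Qed.

Theorem corollary1 (R : realType) (l : nat) (c alpha : R) :
  (2 <= l)%N -> 0 < c -> 0 < alpha < 1 ->
  let q := fun n : nat => 1 - c / n%:R `^ alpha in
  let EN := fun n : nat =>
    mallows_expectation (q n) (fun s : 'S_n => (num_clusters l s)%:R) in
  (exists Cminus Cplus : R,
     [/\ 0 < Cminus, 0 < Cplus &
       \forall n \near \oo,
         Cminus * n%:R `^ (1 - (l%:R - 1) * alpha) <= EN n /\
         EN n <= Cplus * n%:R `^ (1 - (l%:R - 1) * alpha)]) /\
  (l%:R < (1 + alpha) / alpha -> EN n @[n --> \oo] --> +oo) /\
  ((1 + alpha) / alpha < l%:R -> EN n @[n --> \oo] --> (0 : R)).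
Proof.
move=> l2 c0 /andP[a0 a1] q EN.
pose b : R := 1 - (l%:R - 1) * alpha.
(* Both limits follow from the bounds, since comparing [l] with (1 + alpha) / alpha decides the sign
   of the exponent [b]. *)
suff [Cm [Cp [Cm0 Cp0 H]]] : exists Cminus Cplus : R,
    [/\ 0 < Cminus, 0 < Cplus & \forall n \near \oo,
      Cminus * n%:R `^ b <= EN n /\ EN n <= Cplus * n%:R `^ b].
  split; first by exists Cm, Cp.
  split=> lb.
  - have b0 : 0 < b by move: lb; rewrite ltr_pdivlMr // /b; lra.
    apply: (@ger_cvgy _ _ _ _ (fun n => Cm * n%:R `^ b)).
      by apply: filterS H => n [].
    apply/cvgryPge => A; near=> n; rewrite -ler_pdivrMl //.
    by near: n; apply: (cvgryPge _).1; exact: cvg_natr_powR_pinfty.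
  - have b0 : b < 0 by move: lb; rewrite ltr_pdivrMr // /b; lra.
    have C0 C : C * n%:R `^ b @[n --> \oo] --> (0 : R).
      by rewrite -(mulr0 C); apply: cvgMr; exact: cvg_natr_powR0.
    apply: (squeeze_cvgr _ (C0 Cm) (C0 Cp)).
    by apply: filterS H => n [-> ->].
case: l l2 @EN @b => [//|l] l2 EN b.
pose A : R := (16^-1 ^+ 2) ^+ l / 4; pose B : R := (l.+1)`!%:R * 2 ^+ l.+1.
have A0 : 0 < A by rewrite divr_gt0 // !exprn_gt0.
have B0 : 0 < B by rewrite mulr_gt0 ?exprn_gt0 // ltr0n fact_gt0.
(* From here the block size is [l.+1]. The powers of [c] come from (1 - q)^l, and the 1/2 from N + 1
   >= n / 2. *)
exists (A * c ^+ l / 2), (B * c ^+ l).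
split; [by rewrite divr_gt0 // mulr_gt0 ?exprn_gt0 | by rewrite mulr_gt0 ?exprn_gt0 |].
near=> n.
(* This makes N = n - (l + 1) a genuine difference and gives N + 1 = n - l >= n / 2. *)
have ln : (l.*2.+1 <= n)%N by near: n; exact: nbhs_infty_ge.
have na : c < n%:R `^ alpha.
  near: n; apply: (cvgryPgt _).1; exact: cvg_natr_powR_pinfty.
(* Here alpha < 1 enters: this gives (n / 2) x >= 1 for x = 1 - q, and so q^(N+1) <= 1/2. *)
have nc : 2 / c <= n%:R `^ (1 - alpha).
  near: n; apply: (cvgryPge _).1; apply: cvg_natr_powR_pinfty; lra.
have [N nE] : exists N, n = (N + l.+1)%N by exists (n - l.+1)%N; lia.
have n0 : 0 < n%:R :> R by rewrite ltr0n; lia.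
have na0 : 0 < (n%:R : R) `^ alpha by exact: powR_gt0.
pose x := c / (n%:R : R) `^ alpha.
have x0 : 0 < x by exact: divr_gt0.
have x1 : x < 1 by rewrite ltr_pdivrMr // mul1r.
have Nn : (N.+1%:R : R) <= n%:R by rewrite ler_nat; lia.
have nN : (n%:R : R) / 2 <= N.+1%:R.
  by rewrite ler_pdivrMr // -natrM ler_nat; lia.
have xb : x ^+ l * n%:R = c ^+ l * n%:R `^ b.
  rewrite /x expr_div_n -(powR_mulrn l (powR_ge0 n%:R alpha)) -powRrM -mulrA; congr (_ * _).
  rewrite -[X in _ * X](@powRr1 _ n%:R) // -powRN -powRD; last by rewrite (gt_eqF n0) implybT.
  by congr (_ `^ _); rewrite /b -natr1; ring.
have Nx : 1 <= N.+1%:R * x.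
  apply: (@le_trans _ _ (n%:R / 2 * x)); last by rewrite ler_pM2r.
  have : n%:R * x = c * n%:R `^ (1 - alpha).
    by rewrite /x powRB ?(gt_eqF n0) ?implybT // powRr1 //; ring.
  move: nc; rewrite ler_pdivrMr //; lra.
have qN : (1 - x) ^+ N.+1 <= 2^-1 by apply: expr_le_half => //; apply/andP; split; exact: ltW.
have q01 : 0 < 1 - x < 1 by apply/andP; split; lra.
(* The size is a variable [k] so that it can be substituted in the type ['S_k] while [x] keeps its
   dependence on [n]. *)
have E k : k = (N + l.+1)%N -> A * x ^+ l * N.+1%:R <=
    mallows_expectation (1 - x) (fun s : 'S_k => (num_clusters l.+1 s)%:R) <=
    B * x ^+ l * N.+1%:R.
  by move=> ->; have := @mallows_expectation_bounds R (1 - x) l N q01 qN; rewrite subKr.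
have /andP[lo hi] := E n nE.
have Ax0 : 0 <= A * x ^+ l by rewrite mulr_ge0 ?exprn_ge0 // ltW.
have Bx0 : 0 <= B * x ^+ l by rewrite mulr_ge0 ?exprn_ge0 // ltW.
split.
- apply: le_trans lo; apply: le_trans (ler_wpM2l Ax0 nN).
  by rewrite -[A * _ / 2]mulrAC -!mulrA -xb; lra.
- apply: (le_trans hi); apply: (le_trans (ler_wpM2l Bx0 Nn)).
  by rewrite -!mulrA xb.
Unshelve. all: by end_near. Qed.
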